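(* Let $\epsilon>0$. Let $G$ be a finite group and let $T=\gamma_\infty(G)$. Assume that $\Pr^*(T,G)\ge\epsilon$. Then: (1) the index $|G:F_2(G)|$ is $\epsilon$-bounded; (2) the exponent of $G/F(G)$ is $\epsilon$-bounded.
   Context: For subsets $X,Y$ of a finite group, $\Pr(X,Y)=\frac{|\{(x,y)\in X\times Y : xy=yx\}|}{|X||Y|}$. $\pi(X)$ denotes the set of primes dividing $|X|$, and $Syl_p(X)$ the set of Sylow $p$-subgroups of $X$. For subgroups $X,Y$ of a finite group $G$, $\Pr^*(X,Y)$ denotes the maximum real number $\epsilon$ such that for every pair of distinct primes $p\in\pi(X)$ and $q\in\pi(Y)$ there are $P\in Syl_p(X)$ and $Q\in Syl_q(Y)$ with $\Pr(P,Q)\ge\epsilon$; thus ''$\Pr^*(X,Y)\ge\epsilon$'' means that for every such pair of distinct primes there are such $P,Q$ with $\Pr(P,Q)\ge\epsilon$. $\gamma_\infty(G)$ is the intersection of all terms of the lower central series of $G$. $F(G)$ is the Fitting subgroup of $G$ and $F_2(G)$ is the second term of the upper Fitting series, i.e. the full preimage in $G$ of $F(G/F(G))$. The exponent of a finite group is the least positive integer $e$ with $x^e=1$ for all elements $x$. ''$\epsilon$-bounded'' means bounded above by a number depending only on $\epsilon$. *)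

(* Defs.v *)
From mathcomp Require Import all_boot all_order all_algebra all_fingroup.
From mathcomp Require Import all_solvable.
From mathcomp Require Import boolp reals.

Set Implicit Arguments.
Unset Strict Implicit.
Unset Printing Implicit Defensive.

Local Open Scope group_scope.

Definition comm_pairs (gT : finGroupType) (X Y : {set gT}) : {set gT * gT} :=
  [set xy in setX X Y | xy.1 * xy.2 == xy.2 * xy.1].

Definition comm_pr (R : realType) (gT : finGroupType) (X Y : {set gT}) : R :=
  (#|comm_pairs X Y|%:R / (#|X|%:R * #|Y|%:R))%R.

(* The assertion Pr^*(X, Y) >= eps.  It holds vacuously when there is no pair  *)
(* of distinct primes p \in \pi(X), q \in \pi(Y).                              *)
Definition prstar_ge (R : realType) (gT : finGroupType) (X Y : {group gT})
    (eps : R) : Prop :=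
  forall p q : nat, p \in \pi(X) -> q \in \pi(Y) -> p != q ->
  exists P Q : {group gT},
    [/\ P \in 'Syl_p(X), Q \in 'Syl_q(Y) & (eps <= comm_pr R P Q)%R].

Definition gamma_infty (gT : finGroupType) (G : {group gT}) : {set gT} :=
  [set x | `[< forall n : nat, x \in 'L_n(G) >]].

Lemma gamma_infty_group_set (gT : finGroupType) (G : {group gT}) :
  group_set (gamma_infty G).
Proof.
apply/group_setP; split=> [|x y]; rewrite !in_set.
  by apply/asboolP=> n; rewrite group1.
by move=> /asboolP Gx /asboolP Gy; apply/asboolP=> n; rewrite groupM ?Gx ?Gy.
Qed.

Canonical gamma_infty_group (gT : finGroupType) (G : {group gT}) :
  {group gT} := Group (gamma_infty_group_set G).

(* The coset morphism is defined on the normaliser of 'F(G) in gT, but this    *)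
(* preimage is contained in G since 'F(G / 'F(G)) \subset G / 'F(G).           *)
Definition Fitting2 (gT : finGroupType) (G : {group gT}) : {set gT} :=
  coset 'F(G) @*^-1 'F(G / 'F(G)).

Canonical Fitting2_group (gT : finGroupType) (G : {group gT}) : {group gT} :=
  Eval hnf in [group of Fitting2 G].

(* Main.v *)
(* Let P be a Sylow p-subgroup of T and Q a Sylow q-subgroup of G with         *)
(* Pr(P, Q) >= eps.  Neumann's argument gives subgroups of bounded index of P  *)
(* (resp. Q) all of whose elements have centralisers of bounded index in Q     *)
(* (resp. P); for p beyond a bound, this means that a subgroup of bounded      *)
(* index of Q centralises P.  Hence a Sylow q-subgroup Q of G with q large has *)
(* normaliser of bounded index in T, so it has fewer than q conjugates in      *)
(* T Q <| G and is normal in G: only boundedly many primes matter modulo 'F(G).*)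
(*   For these, suppose that all elements x of a subgroup of bounded index of  *)
(* P = S :&: A, with S Sylow in H and A <| H, have class size with bounded     *)
(* p'-part m.  Then x lies in a proportion >= 1 / m of the conjugates of S, so *)
(* P is commensurable with P :^ g for a positive proportion of the g in H,     *)
(* hence uniformly so for all g in a subgroup H1 of bounded index.  By the     *)
(* Bergman-Lenstra theorem P is commensurable with a normal subgroup of H1,    *)
(* and therefore 'O_p(H) has bounded index in P.                               *)
(*   With H = T Q, A = H this bounds |G : F_2(G)| after passing to G / 'F(G);  *)
(* with A the centraliser of the large Sylow subgroups of T it bounds the      *)
(* exponent of G / 'F(G).                                                      *)

Require Import Defs.
From mathcomp Require Import all_boot all_order all_algebra all_fingroup.
From mathcomp Require Import all_solvable.
From mathcomp Require Import boolp reals.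

Set Implicit Arguments.
Unset Strict Implicit.
Unset Printing Implicit Defensive.

Import Order.TTheory GRing.Theory Num.Theory.

Local Open Scope group_scope.

(** Write T for the intersection of the lower central series, so that G/T is nilpotent. The engine
    is [gen_dense_set]: a symmetric set of density 1/k generates a subgroup in at most 3k+1 factors.
    A property that degrades in a controlled way along products thus passes from a positive
    proportion of elements to a subgroup of bounded index. For centraliser indices this turns Pr(P,
    Q) >= eps into near commutation ([comm_dense_subgroup]). For |P : P^g| it makes P nearly
    invariant under a subgroup of bounded index, where [bergman_lenstra] provides a commensurable
    normal subgroup; this is how [Sylow_pcore_index] reaches O_p.

    A p-group with p > c has no proper subgroup of index at most c, so for large primes near
    commutation becomes centralisation, and counting Sylow subgroups modulo q gives
    [large_Sylow_normal]. Small primes are treated by [nearly_commuting_pcore_index], which bounds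
    |Q :&: C : O_q(G)| once Q :&: C centralises the large Sylow subgroups of T. In G/F(G) no large
    prime is left, so C is the whole group and the index of the Fitting subgroup has bounded prime
    parts. In G itself C is a centraliser: a fixed power of each q-element lies in C, and a further
    fixed power in O_q(G), which bounds the exponent. *)

(** * Averaging, and bounded generation by dense symmetric sets *)

Lemma dense_fibers (I J : finType) (A : {set I}) (B : {set J})
    (r : I -> J -> bool) (k : nat) :
  0 < #|B| ->
  2 * (#|A| * #|B|) <= k * \sum_(a in A) #|[set b in B | r a b]| ->
  #|A| <= k * #|[set a in A | #|B| <= k * #|[set b in B | r a b]|]|.
Proof.
move=> B0 dense; rewrite -(leq_pmul2r B0).
set X := [set a in A | _].
have XA : X = A :&: X by apply/esym/setIidPr/subsetP=> a; rewrite inE => /andP[].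
(* Elements outside [X] account for at most [#|A| * #|B|], half of the assumed mass; those in [X],
   with fibres of size at most [#|B|], must supply the other half. *)
have : k * \sum_(a in A) #|[set b in B | r a b]|
       <= \sum_(a in A) (if a \in X then k * #|B| else 0) + \sum_(a in A) #|B|.
  rewrite big_distrr -big_split; apply: leq_sum => a Aa /=.
  rewrite inE Aa /=; case: ifP => [_|/negbT]; last by rewrite -ltnNge => /ltnW.
  rewrite (leq_trans _ (leq_addr _ _)) // leq_mul2l subset_leq_card ?orbT //.
  by apply/subsetP=> b; rewrite inE => /andP[].
have -> : \sum_(a in A) (if a \in X then k * #|B| else 0) = (k * #|X| * #|B|)%N.
  rewrite -big_mkcondr (eq_bigl (mem X)) => [|a].
    by rewrite sum_nat_const mulnCA mulnA.
  by rewrite /= [in RHS]XA in_setI.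
rewrite sum_nat_const => /(leq_trans dense).
by rewrite mul2n -addnn leq_add2r.
Qed.

Section BoundedGeneration.

Variables (gT : finGroupType) (X : {set gT}).
Hypotheses (X1 : 1 \in X) (XV : forall x, x \in X -> x^-1 \in X).

Lemma subset_expgSr (n : nat) : X ^+ n \subset X ^+ n.+1.
Proof. by rewrite expgSr; apply/subsetP=> x ?; rewrite -[x]mulg1 mem_mulg. Qed.

Lemma expg_set_stable (m n : nat) :
  X ^+ m.+1 = X ^+ m -> m <= n -> X ^+ n = X ^+ m.
Proof.
move=> st /subnKC <-; elim: (n - m) => [|i IH]; first by rewrite addn0.
by rewrite addnS expgSr IH -expgSr.
Qed.

Lemma proper_expgSr (m n : nat) :
  X ^+ n.+1 != X ^+ n -> m <= n -> X ^+ m \proper X ^+ m.+1.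
Proof.
move=> nst lemn; rewrite properEneq subset_expgSr andbT.
apply: contra nst => /eqP/esym st.
by rewrite (expg_set_stable st lemn) (expg_set_stable st (leqW lemn)).
Qed.

(** If z lies in X^(n+2) but not in X^(n+1), symmetry of X makes zX disjoint from X^n, and X^(n+3)
    contains both. *)
Lemma card_expg_add3 (n : nat) :
  X ^+ n.+1 \proper X ^+ n.+2 -> #|X| + #|X ^+ n| <= #|X ^+ n.+3|.
Proof.
case/properP=> _ [z z2 z1].
have dj : [disjoint z *: X & X ^+ n].
  rewrite -setI_eq0; apply/eqP/setP=> y; rewrite !inE.
  apply/negP=> /andP[/lcosetP[x Xx yE] yn]; case/negP: z1.
  have -> : z = y * x^-1 by rewrite yE mulgK.
  by rewrite expgSr mem_mulg ?XV.
rewrite -(card_lcoset X z); have/leqifP := leq_card_setU (z *: X) (X ^+ n).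
rewrite dj => /eqP <-; apply: subset_leq_card; rewrite subUset; apply/andP; split.
  by apply/subsetP=> y /lcosetP[x Xx ->]; rewrite expgSr mem_mulg.
by rewrite !(subset_trans _ (subset_expgSr _)).
Qed.

Lemma expg_set_growth (j n : nat) :
  3 * j <= n -> X ^+ n.+2 != X ^+ n.+1 -> j.+1 * #|X| <= #|X ^+ (3 * j).+1|.
Proof.
elim: j => [|j IH] lejn nst; first by rewrite muln0 mul1n expg1.
rewrite mulnS !addSn add0n in lejn *; move: (3 * j)%N IH lejn => m IH lemn.
have lemn' : m <= n by rewrite (leq_trans _ lemn) // -addn3 leq_addr.
rewrite mulSn (leq_trans _ (card_expg_add3 _)) ?leq_add2l ?IH //.
by apply: (proper_expgSr nst); rewrite ltnS (leq_trans _ lemn) // ltnS -addn2 leq_addr.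
Qed.

(** Growth by |X| every three steps would give X^(3k+1) at least (k+1)|X| elements, more than |G|.
    So the powers are stationary by then, and a stationary power is a group. *)
Lemma gen_dense_set (G : {group gT}) (k : nat) :
  X \subset G -> #|G| <= k * #|X| -> <<X>> = X ^+ (3 * k).+1.
Proof.
move=> sXG dense; set n := (3 * k).+1.
have sXnG m : X ^+ m \subset G.
  elim: m => [|m IH]; first by rewrite expg0 sub1G.
  by rewrite expgSr mul_subG.
have st : X ^+ n.+1 = X ^+ n.
  apply/eqP; apply: contraT => /(expg_set_growth (leqnn _)) big.
  have := leq_trans big (leq_trans (subset_leq_card (sXnG _)) dense).
  rewrite leq_mul2r ltnn orbF => /eqP/cards0_eq X0.
  by move: X1; rewrite X0 inE.
have gXn : group_set (X ^+ n).
  apply/andP; split; first by elim: n {st} => [|m IH]; rewrite ?inE // (subsetP (subset_expgSr m)).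
  by rewrite -expgnDr (expg_set_stable st) // leq_addr.
apply/eqP; rewrite eqEsubset; apply/andP; split.
  rewrite (gen_subG X (Group gXn)) /= /n.
  elim: (3 * k)%N => [|m IH]; first by rewrite expg1.
  exact: subset_trans IH (subset_expgSr _).
elim: {st gXn} n => [|m IH]; first by rewrite expg0 sub1G.
by rewrite expgSr mul_subG // subset_gen.
Qed.

End BoundedGeneration.

(** * Index estimates, where [#|G : H|] means |G : G :&: H| for arbitrary subgroups *)

Lemma leq_index_setI (gT : finGroupType) (G H K : {group gT}) :
  #|G : H :&: K| <= #|G : H| * #|G : K|.
Proof.
have D0 : 0 < #|G :&: (H :&: K)| by exact: cardG_gt0.
rewrite -(leq_pmul2l D0) (LagrangeI G (H :&: K)%G) -(leq_pmul2l (cardG_gt0 G)).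
rewrite -{1}(LagrangeI G H) -{1}(LagrangeI G K) mulnACA [leqRHS]mulnA leq_mul2r.
apply/orP; right; rewrite mul_cardG setIACA setIid leq_mul2r.
by rewrite (subset_leq_card (_ : _ \subset G)) ?orbT // mul_subG ?subsetIl.
Qed.

Lemma leq_index_subset (gT : finGroupType) (G H K : {group gT}) :
  H \subset G -> #|H : K| <= #|G : K|.
Proof.
move=> sHG; have H0 : 0 < #|H :&: K| by exact: cardG_gt0.
rewrite -(leq_pmul2l H0) LagrangeI -(leq_pmul2l (cardG_gt0 (G :&: K))).
rewrite mulnCA LagrangeI mul_cardG mulnC leq_mul //.
  by apply: subset_leq_card; rewrite setIAC (setIidPr sHG).
by rewrite subset_leq_card // mul_subG ?subsetIl.
Qed.

Lemma leq_index_bigcap (gT : finGroupType) (G : {group gT}) (I : finType)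
    (P : pred I) (F : I -> {group gT}) (k n : nat) :
  0 < k -> #|P| <= n -> (forall i, P i -> #|G : F i| <= k) ->
  #|G : \bigcap_(i | P i) F i| <= k ^ n.
Proof.
move=> k0 Pn Fk; apply: leq_trans (leq_pexp2l k0 Pn).
rewrite -prod_nat_const.
suff [K <- KG] : exists2 K : {group gT},
    K = \bigcap_(i | P i) F i :> {set gT} & #|G : K| <= \prod_(i | P i) k.
  by [].
apply: (big_rec2 (fun (A : {set gT}) m =>
  exists2 K : {group gT}, K = A :> {set gT} & #|G : K| <= m)).
  by exists [set: gT]%G; rewrite // -indexgI setIT indexgg.
move=> i m A Pi [K <- KG]; exists (F i :&: K)%G => //.
by rewrite (leq_trans (leq_index_setI _ _ _)) // leq_mul // Fk.
Qed.

Lemma leq_index_gcore (gT : finGroupType) (G H : {group gT}) (k : nat) :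
  #|G : H| <= k -> #|G : gcore H G| <= k ^ k.
Proof.
move=> Gk; have k0 : 0 < k by apply: leq_trans Gk; exact: indexg_gt0.
(* The conjugate [H :^ x] depends only on the coset [H :* x], so the core is an intersection of at
   most k conjugates. *)
pose F (C : {set gT}) := (H :^ repr C)%G.
have FE x : F (H :* x) = H :^ x :> {set gT}.
  have /rcosetP[h Hh] := mem_repr_rcoset H x.
  by rewrite /F /= => ->; rewrite conjsgM conjGid.
have -> : gcore H G = \bigcap_(C in rcosets H G) F C.
  apply/setP=> y; apply/bigcapP/bigcapP => Hy.
    by move=> C /rcosetsP[x Gx ->]; rewrite FE Hy.
  by move=> x Gx; rewrite -FE Hy //; apply/rcosetsP; exists x.
apply: leq_index_bigcap => // C /rcosetsP[x Gx ->].
by rewrite FE -{1}(conjGid Gx) indexJg.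
Qed.

(** A prime dividing n is at most its own part of n, hence at most c; so n is a product of at most c
    parts, each at most c. *)
Lemma leq_exp_of_parts (n c : nat) :
  0 < n -> (forall p, p \in \pi(n) -> n`_p <= c) -> n <= c ^ c.
Proof.
move=> n0 nc; rewrite {1}(prod_prime_decomp n0) prime_decompE big_map /=.
apply: (@leq_trans (\prod_(p <- primes n) c)).
  rewrite big_seq [leqRHS]big_seq.
  by apply: leq_prod => p pn; rewrite -p_part nc.
rewrite big_const_seq count_predT iter_muln_1.
have le_c p : p \in primes n -> 0 < p <= c.
  move=> pn; rewrite (leq_trans _ (nc p pn)) ?andbT.
    by rewrite prime_gt0 //; move: pn; rewrite mem_primes => /andP[].
  move: (pn); rewrite mem_primes => /and3P[pp _ pdn].
  by rewrite p_part -{1}[p]expn1 leq_exp2l ?prime_gt1 // logn_gt0.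
case: c => [|c] in nc le_c *.
  case: (primes n) le_c => // p s /(_ p (mem_head _ _)); by case: p.
rewrite leq_pexp2l // -[leqRHS](size_iota 1); apply: uniq_leq_size => [|p /le_c].
  exact: primes_uniq.
by rewrite mem_iota.
Qed.

(** |P| is the full p-part of |G|, while the p-group P :&: H has order at most the p-part of |G :&:
    H|. *)
Lemma leq_index_part (gT : finGroupType) (p : nat) (G P H : {group gT}) :
  p.-Sylow(G) P -> (#|G : H|`_p <= #|P : H|)%N.
Proof.
move=> sylP; have GH0 : 0 < #|G :&: H|`_p by exact: part_gt0.
rewrite -(leq_pmul2l GH0) -partnM ?cardG_gt0 ?indexg_gt0 // LagrangeI.
rewrite -(card_Hall sylP) -(LagrangeI P H) leq_mul2r; apply/orP; right.
have pPH : p.-group (P :&: H) by apply: pgroupS (pHall_pgroup sylP); exact: subsetIl.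
rewrite -[leqLHS](part_pnat_id pPH) dvdn_leq // partn_dvd ?cardG_gt0 //.
by rewrite cardSg // setSI ?(pHall_sub sylP).
Qed.

Lemma leq_index_cent1M (gT : finGroupType) (G : {group gT}) (x y : gT) :
  #|G : 'C[x * y]| <= #|G : 'C[x]| * #|G : 'C[y]|.
Proof.
apply: leq_trans (leq_index_setI _ _ _).
rewrite dvdn_leq ?indexg_gt0 // indexgS //.
apply/subsetP=> z /setIP[/cent1P zx /cent1P zy].
by apply/cent1P; exact: commuteM.
Qed.

(** * Neumann's argument: many commuting pairs give small classes on a large subgroup *)

Lemma sum_comm_pairs (gT : finGroupType) (X Y : {set gT}) :
  #|comm_pairs X Y| = \sum_(x in X) #|[set y in Y | (x * y == y * x)%g]|.
Proof.
rewrite -sum1_card.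
rewrite (eq_bigl (fun u : gT * gT =>
  (u.1 \in X) && ((u.2 \in Y) && (u.1 * u.2 == u.2 * u.1)%g))); last first.
  by move=> u; rewrite !inE andbA.
rewrite -(pair_big_dep (mem X) (fun x y => (y \in Y) && (x * y == y * x)%g)
  (fun _ _ => 1%N)) /=.
by apply: eq_bigr => x _; rewrite -sum1_card; apply: eq_bigl => y; rewrite inE.
Qed.

Lemma card_comm_pairsC (gT : finGroupType) (X Y : {set gT}) :
  #|comm_pairs X Y| = #|comm_pairs Y X|.
Proof.
have swap_inj : injective (fun u : gT * gT => (u.2, u.1)) by move=> [a b] [c d] [-> ->].
rewrite -(card_imset _ swap_inj); apply: eq_card => -[x y].
apply/imsetP/idP => [[[u v] /setIdP[/setXP[/= Xu Yv] /eqP uv] [-> ->]]|].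
  by rewrite !inE Xu Yv /= uv.
rewrite !inE /= => /andP[/andP[Yx Xy] /eqP xy].
by exists (y, x) => //; rewrite !inE /= Yx Xy xy /=.
Qed.

(** The elements of Q whose centraliser has index at most k in P form a symmetric set of density at
    least 1/k. Centraliser indices are submultiplicative, and elements of the generated group need
    only 3k+1 factors. *)
Lemma comm_dense_subgroup (gT : finGroupType) (P Q : {group gT}) (k : nat) :
  2 * (#|Q| * #|P|) <= k * #|comm_pairs Q P| ->
  exists2 Q0 : {group gT}, Q0 \subset Q /\ #|Q : Q0| <= k &
    forall x, x \in Q0 -> #|P : 'C[x]| <= k ^ (3 * k).+1.
Proof.
rewrite sum_comm_pairs => /(dense_fibers (cardG_gt0 P)).
set X := [set x in Q | _] => dense.
have memX x : (x \in X) = (x \in Q) && (#|P : 'C[x]| <= k).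
  rewrite inE; congr (_ && _).
  have -> : [set y in P | x * y == y * x] = P :&: 'C[x].
    by apply/setP=> y; rewrite in_setI inE; congr (_ && _); apply/eqP/cent1P => /esym.
  by rewrite -{1}(LagrangeI P 'C[x]) mulnC leq_pmul2r ?cardG_gt0.
have k0 : 0 < k.
  by rewrite lt0n; apply/eqP=> k0; move: dense; rewrite k0 mul0n leqNgt cardG_gt0.
have iC1 : #|P : 'C[1]| = 1%N.
  rewrite -indexgI (setIidPl _) ?indexgg //.
  by apply/subsetP=> y _; exact/cent1P/commute1.
have X1 : 1 \in X by rewrite memX group1 iC1.
have XV x : x \in X -> x^-1 \in X by rewrite !memX groupV -!cent_cycle cycleV.
have sXQ : X \subset Q by apply/subsetP=> x; rewrite inE => /andP[].
have genX := gen_dense_set X1 XV sXQ dense.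
exists <<X>>%G; first split; first by rewrite gen_subG.
  rewrite -(leq_pmul2l (cardG_gt0 <<X>>%G)) Lagrange ?gen_subG //= mulnC.
  by rewrite (leq_trans dense) // leq_mul2l subset_leq_card ?orbT ?subset_gen.
move=> x; rewrite /= genX; elim: (3 * k).+1 x => [|n IH] x.
  by rewrite expg0 => /set1P ->; rewrite iC1 expn0.
rewrite expgSr => /mulsgP[y z yX]; rewrite memX => /andP[_ zk] ->.
by rewrite expnSr (leq_trans (leq_index_cent1M _ _ _)) // leq_mul // IH.
Qed.

(** * The Bergman-Lenstra theorem on subgroups commensurable with their conjugates *)

Section ConjugateIntersections.

Variables (gT : finGroupType) (G P : {group gT}).

Definition conj_meet (A : {set gT}) : {group gT} := (\bigcap_(a in A) P :^ a)%G.

(** Measures how far the intersection is from lying in every conjugate of P. Enlarging A can only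
    lower it, which makes an extremal choice of A possible. *)
Definition max_conj_index (A : {set gT}) : nat :=
  \max_(g in G) #|conj_meet A : P :^ g|.

Lemma mem_conj_meet (A : {set gT}) (x : gT) :
  reflect (forall a, a \in A -> x \in P :^ a) (x \in conj_meet A).
Proof. exact: bigcapP. Qed.

Lemma conj_meetS (A B : {set gT}) : A \subset B -> conj_meet B \subset conj_meet A.
Proof.
move=> sAB; apply/subsetP=> x /mem_conj_meet xB; apply/mem_conj_meet=> a Aa.
exact/xB/(subsetP sAB).
Qed.

Lemma conj_meet_sub (A : {set gT}) : 1 \in A -> conj_meet A \subset P.
Proof. by move=> A1; apply/subsetP=> x /mem_conj_meet/(_ 1 A1); rewrite conjsg1. Qed.

Lemma conj_meetJ (A : {set gT}) (g : gT) :
  conj_meet A :^ g = conj_meet (A :* g) :> {set gT}.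
Proof.
apply/setP=> x; rewrite mem_conjg; apply/mem_conj_meet/mem_conj_meet => xA.
  by move=> _ /rcosetP[a /xA xa ->]; rewrite conjsgM mem_conjg.
by move=> a Aa; rewrite -mem_conjg -conjsgM xA // mem_rcoset mulgK.
Qed.

Variable n : nat.
Hypothesis Pn : forall g, g \in G -> #|P : P :^ g| <= n.

Let n_gt0 : 0 < n.
Proof. exact: leq_trans (indexg_gt0 _ _) (Pn (group1 G)). Qed.

Lemma leq_index_conj_meet (A : {set gT}) :
  A \subset G -> #|P : conj_meet A| <= n ^ #|A|.
Proof.
by move=> /subsetP sAG; apply: leq_index_bigcap => // a /sAG /Pn.
Qed.

Lemma leq_max_conj_index (A : {set gT}) (g h : gT) :
  g \in G -> h \in G -> #|conj_meet A :^ g : P :^ h| <= max_conj_index A.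
Proof.
move=> Gg Gh; have -> : P :^ h = (P :^ (h * g^-1)) :^ g by rewrite -conjsgM mulgKV.
rewrite indexJg; apply: (@leq_bigmax_cond _ _ (fun g => #|conj_meet A : P :^ g|)).
by rewrite groupM ?groupV.
Qed.

Lemma max_conj_index_le (A : {set gT}) : 1 \in A -> max_conj_index A <= n.
Proof.
move=> A1; apply/bigmax_leqP=> g /Pn; apply: leq_trans.
exact/leq_index_subset/conj_meet_sub.
Qed.

Lemma max_conj_indexP (A : {set gT}) :
  exists2 h, h \in G & max_conj_index A = #|conj_meet A : P :^ h|.
Proof.
by have [h] := eq_bigmax_cond (fun h => #|conj_meet A : P :^ h|) (cardG_gt0 G); exists h.
Qed.

End ConjugateIntersections.

Lemma sub_gen_rstable (gT : finGroupType) (Y Z : {set gT}) :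
  1 \in Y -> Y * Z \subset Y -> <<Z>> \subset Y.
Proof.
move=> Y1 sYZ; apply/subsetP=> x /gen_prodgP[m [c Zc ->]].
elim: m c Zc => [|m IH] c Zc; first by rewrite big_ord0.
rewrite big_ord_recr /=; apply: (subsetP sYZ); by rewrite mem_mulg ?IH.
Qed.

Lemma leq_card_mulg (gT : finGroupType) (A B : {set gT}) :
  #|A * B| <= #|A| * #|B|.
Proof.
have -> : A * B = [set u.1 * u.2 | u in setX A B].
  apply/setP=> x; apply/mulsgP/imsetP => [[a b Aa Bb ->]|[[a b] /setXP[Aa Bb] ->]].
    by exists (a, b) => //; apply/setXP.
  by exists a b.
by rewrite -cardsX leq_imset_card.
Qed.

(** Each failure of stability yields a larger set of controlled size with strictly smaller index.
    This can happen at most m times, so K comes from iterating F and is uniform over all groups. *)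
Lemma stable_conj_meet (F : nat -> nat) (m k : nat) :
  exists K : nat, forall (gT : finGroupType) (G P : {group gT}) (A : {set gT}),
    1 \in A -> A \subset G -> #|A| <= k -> max_conj_index G P A <= m ->
  exists A' : {set gT}, [/\ 1 \in A', A' \subset G, #|A'| <= K &
    forall B : {set gT}, A' \subset B -> B \subset G -> #|B| <= F #|A'| ->
      max_conj_index G P A' <= max_conj_index G P B].
Proof.
elim: m k => [|m IH] k.
  exists k => gT G P A A1 sAG Ak; rewrite leqn0 => /eqP dA.
  by exists A; split=> // B; rewrite dA.
have [K hK] := IH (\max_(i < k.+1) F i); exists (maxn k K) => gT G P A A1 sAG Ak dA.
have [[B sAB [sBG BF dB]]|noB] :=
  pselect (exists2 B : {set gT}, A \subset B &
    [/\ B \subset G, #|B| <= F #|A| & max_conj_index G P B < max_conj_index G P A]).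
  have BF' : #|B| <= \max_(i < k.+1) F i.
    apply: leq_trans BF _; pose i : 'I_k.+1 := Ordinal (Ak : #|A| < k.+1).
    exact: (@leq_bigmax _ (fun i : 'I_k.+1 => F i) i).
  have [|A' [A'1 sA'G A'K stA']] := hK gT G P B (subsetP sAB _ A1) sBG BF'.
    by rewrite -ltnS (leq_trans dB).
  by exists A'; split=> //; rewrite leq_max A'K orbT.
exists A; split=> [//|//||B sAB sBG BF]; first by rewrite leq_max Ak.
by rewrite leqNgt; apply/negP=> dB; apply: noB; exists B.
Qed.

(* If no [P :^ h] meets [M] in smaller index than it meets [N], then some      *)
(* [P :^ h] satisfies [N :^ g = M (N :^ g :&: P :^ h)] for all [g] in [R], so  *)
(* that [P :^ h * M] absorbs every [N :^ g].                                   *)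
Lemma card_join_conj (gT : finGroupType) (G P : {group gT}) (n : nat)
    (A R : {set gT}) :
  (forall g, g \in G -> #|P : P :^ g| <= n) ->
  1 \in A -> A \subset G -> 1 \in R -> R \subset G ->
  max_conj_index G P A <= max_conj_index G P (A * R) ->
  #|<<\bigcup_(g in R) conj_meet P A :^ g>>| <= n ^ #|A|.+1 * #|conj_meet P A|.
Proof.
move=> Pn A1 sAG R1 sRG stab; set N := conj_meet P A.
pose M := conj_meet P (A * R).
have sMN g : g \in R -> M \subset N :^ g.
  by move=> Rg; rewrite conj_meetJ conj_meetS // mulgS ?sub1set.
have [h Gh dM] := max_conj_indexP G P (A * R).
have NgE g : g \in R -> N :^ g = (N :^ g :&: P :^ h) * M.
  move=> Rg; apply/eqP; rewrite eq_sym eqEcard mul_subG ?subsetIl ?sMN //=.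
  have MP0 : 0 < #|M :&: P :^ h| by exact: cardG_gt0.
  have cE : (#|N :^ g :&: P :^ h| * #|M|)%N
          = (#|((N :^ g :&: P :^ h) * M)%g| * #|M :&: P :^ h|)%N.
    by rewrite (mul_cardG (N :^ g :&: P :^ h)%G M) setIAC (setIidPr (sMN g Rg)).
  rewrite -(leq_pmul2r MP0) -cE -(LagrangeI (N :^ g)%G (P :^ h)%G) -mulnA leq_mul2l.
  apply/orP; right; rewrite mulnC -[leqRHS](LagrangeI M (P :^ h)%G) leq_mul2l.
  apply/orP; right.
  have /leq_trans := leq_max_conj_index P A (subsetP sRG _ Rg) Gh; apply.
  by rewrite (leq_trans stab) // dM.
have sKPM : <<\bigcup_(g in R) N :^ g>> \subset P :^ h * M.
  apply: sub_gen_rstable; first by rewrite -[1]mulg1 mem_mulg ?group1.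
  apply/subsetP=> _ /mulsgP[x y Px /bigcupP[g Rg Ny] ->].
  rewrite -[_ * M](_ : P :^ h * N :^ g = _); last first.
    by rewrite {1}(NgE g Rg) mulgA mulGSid ?subsetIr.
  rewrite -(mulSGid (sMN g Rg)) mulgA mem_mulg //.
(* |P^h M| = |P| |M : P^h|, where |P| is at most n^|A| |N| and |M : P^h| is at most n; hence the
   exponent |A|+1. *)
apply: leq_trans (subset_leq_card sKPM) _.
have MP0 : 0 < #|M :&: P :^ h| by exact: cardG_gt0.
rewrite -(leq_pmul2r MP0) setIC -(mul_cardG (P :^ h)%G M) setIC.
rewrite -(LagrangeI M (P :^ h)%G) mulnCA [leqRHS]mulnC leq_mul2l; apply/orP; right.
rewrite cardJg expnS -mulnA mulnC leq_mul //.
  have -> : #|M : P :^ h| = max_conj_index G P (A * R) by rewrite dM.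
  by apply: max_conj_index_le Pn _ _; rewrite -[1]mulg1 mem_mulg.
rewrite -(Lagrange (conj_meet_sub P A1)) mulnC leq_mul2r.
by rewrite (leq_index_conj_meet Pn) ?orbT.
Qed.

(** For a stable A, few conjugates of N generate a group of order at most b|N|. Each conjugate not
    yet contained in that group at least doubles it, adding |N| or more, so within b additions all
    conjugates are absorbed and the generated group is normal. *)
Theorem bergman_lenstra (n : nat) :
  exists K : nat, forall (gT : finGroupType) (G P : {group gT}),
    P \subset G -> (forall g, g \in G -> #|P : P :^ g| <= n) ->
  exists L N : {group gT},
    [/\ L <| G, N \subset L, N \subset P, #|P : N| <= K & #|L : N| <= K].
Proof.
(* The growth function lets A be replaced by A R for every R of size at most b+1, where b =
   n^(|A|+1). *)
have [K hK] := stable_conj_meet (fun i => (n ^ i.+1).+1 * i)%N n 1.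
exists (n.+1 ^ K.+1)%N => gT G P sPG Pn.
have [||||A [A1 sAG AK stA]] := hK gT G P [set 1].
- exact: set11.
- by rewrite sub1set.
- by rewrite cards1.
- exact: max_conj_index_le Pn _ (set11 _).
set N := conj_meet P A; set b := (n ^ #|A|.+1)%N.
have powK i : i <= K.+1 -> n ^ i <= n.+1 ^ K.+1.
  move=> iK; apply: leq_trans (leq_pexp2l _ iK) => //.
  by case: i {iK} => // i; rewrite leq_exp2r.
pose J (R : {set gT}) := <<\bigcup_(g in R) N :^ g>>%G.
have sNJ (R : {set gT}) g : g \in R -> N :^ g \subset J R.
  by move=> Rg; rewrite sub_gen // (bigcup_sup g).
have JRb (R : {set gT}) : 1 \in R -> R \subset G -> #|R| <= b.+1 ->
    #|J R| <= b * #|N|.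
  move=> R1 sRG Rb; apply: (card_join_conj Pn) => //; apply: stA.
  - by apply/subsetP=> a Aa; rewrite -[a]mulg1 mem_mulg.
  - by rewrite mul_subG.
  - by rewrite (leq_trans (leq_card_mulg _ _)) // mulnC leq_mul2r Rb orbT.
have step j : j <= b ->
    (exists2 R : {set gT}, [/\ 1 \in R, R \subset G & #|R| <= b.+1] &
      forall g, g \in G -> N :^ g \subset J R) \/
    (exists2 R : {set gT}, [/\ 1 \in R, R \subset G & #|R| = j.+1] &
      j.+1 * #|N| <= #|J R|).
  elim: j => [_|j IH jb].
    right; exists [set 1]; first by rewrite set11 sub1set group1 cards1.
    by rewrite mul1n /J /= big_set1 conjsg1 genGid.
  case: (IH (ltnW jb)) => [|[R [R1 sRG Rj] JR]]; first by left.
  have [/forall_inP allJ|] := boolP [forall g in G, N :^ g \subset J R].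
    by left; exists R; rewrite // R1 sRG Rj ltnS ltnW.
  rewrite negb_forall_in => /exists_inP[g Gg NgJ]; right.
  have R'g : g \notin R by apply: contra NgJ; exact: sNJ.
  exists (g |: R); first by rewrite inE R1 orbT subUset sub1set Gg sRG cardsU1 R'g Rj.
  have sJ : J R \subset J (g |: R) by rewrite genS // bigcup_setU subsetUr.
  have J2 : 1 < #|J (g |: R) : J R|.
    rewrite indexg_gt1; apply: contra NgJ; apply: subset_trans.
    by rewrite sNJ // setU11.
  have sNJR : #|N| <= #|J R|.
    by rewrite subset_leq_card // -[gval N]conjsg1 sNJ.
  rewrite -(Lagrange sJ) (leq_trans _ (leq_mul (leqnn _) J2)) // muln2 -addnn.
  by rewrite mulSn leq_add.
have [[R [R1 sRG Rb] JR]|[R [R1 sRG Rb]]] := step b (leqnn b); last first.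
  move/leq_trans/(_ (JRb R R1 sRG _)); rewrite Rb leqnn => /(_ isT).
  by rewrite leq_pmul2r ?ltnn ?cardG_gt0.
have sNJR : N \subset J R by rewrite -[gval N]conjsg1 JR.
exists (J R), N; split=> //.
- apply/normalP; split.
    rewrite gen_subG; apply/bigcupsP=> g /(subsetP sRG) Gg.
    by rewrite conj_subG // (subset_trans (conj_meet_sub _ A1)).
  move=> x Gx; apply/eqP; rewrite eqEcard cardJg leqnn andbT -genJ gen_subG.
  apply/subsetP=> _ /imsetP[y /bigcupP[g Rg Ny] ->].
  have Ggx : g * x \in G by rewrite groupM // (subsetP sRG).
  by rewrite (subsetP (JR _ Ggx)) // conjsgM memJ_conjg.
- exact: conj_meet_sub.
- by rewrite (leq_trans (leq_index_conj_meet Pn sAG)) // powK // leqW.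
rewrite -(leq_pmul2r (cardG_gt0 N)) mulnC Lagrange //.
by rewrite (leq_trans (JRb R R1 sRG Rb)) // leq_mul2r powK ?orbT.
Qed.

(** * From small classes of p-elements to a large O_p *)

Lemma leq_index_trans (gT : finGroupType) (A B C : {group gT}) :
  #|A : C| <= #|A : B| * #|B : C|.
Proof.
apply: (@leq_trans #|A : B :&: C|).
  by rewrite dvdn_leq ?indexg_gt0 // indexgS // subsetIr.
have -> : #|A : B :&: C| = (#|A : B| * #|A :&: B : C|)%N.
  apply/eqP; rewrite -(eqn_pmul2l (cardG_gt0 (A :&: (B :&: C))%G)).
  rewrite (LagrangeI A (B :&: C)%G) mulnCA /= setIA (LagrangeI (A :&: B)%G C).
  by rewrite mulnC LagrangeI.
by rewrite leq_mul2l leq_index_subset ?orbT // subsetIr.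
Qed.

Lemma indexgJC (gT : finGroupType) (P : {group gT}) (g : gT) :
  #|P :^ g : P| = #|P : P :^ g|.
Proof.
apply/eqP; rewrite -(eqn_pmul2l (cardG_gt0 (P :&: P :^ g)%G)) LagrangeI.
by rewrite /= setIC (LagrangeI (P :^ g)%G P) cardJg.
Qed.

(* [S * 'C_H[x]] consists of such [g], and as [S] is Sylow the intersection    *)
(* [S :&: 'C[x]] is too small for this product set to be small.                *)
Lemma conj_Sylow_density (gT : finGroupType) (p m : nat) (H S : {group gT}) (x : gT) :
  p.-Sylow(H) S -> x \in S -> (#|H : 'C[x]|`_p^' <= m)%N ->
  #|H| <= m * #|[set g in H | x \in S :^ g]|.
Proof.
move=> sylS Sx Hm; have sSH := pHall_sub sylS.
set C := 'C_H[x]%G; pose U := [set g in H | x \in S :^ g].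
have sSCU : S * C \subset U.
  apply/subsetP=> _ /mulsgP[s c Ss /setIP[Hc /cent1P cxc] ->].
  apply/setIdP; split; first by rewrite groupM // (subsetP sSH).
  rewrite conjsgM conjGid // mem_conjg.
  by rewrite conjgE invgK mulgA cxc mulgK.
have pSC : p.-group (S :&: C) by apply: pgroupS (subsetIl _ _) (pHall_pgroup sylS).
have leSC : #|S :&: C| <= #|C|`_p.
  by rewrite -(part_pnat_id pSC) dvdn_leq // partn_dvd ?cardG_gt0 // cardSg ?subsetIr.
apply: leq_trans (leq_mul (leqnn m) (subset_leq_card sSCU)).
rewrite -(partnC p (cardG_gt0 H)) -(card_Hall sylS) -(LagrangeI H 'C[x]%G).
rewrite partnM ?cardG_gt0 ?indexg_gt0 // mulnA mulnC leq_mul //.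
have C0 : 0 < #|C|`_p by exact: part_gt0.
rewrite -(leq_pmul2r C0) -mulnA [(_ * #|C|`_p)%N]mulnC partnC ?cardG_gt0 //.
by rewrite mul_cardG leq_mul2l leSC orbT.
Qed.

Lemma exchange_card (I J : finType) (A : {set I}) (B : {set J}) (r : I -> J -> bool) :
  \sum_(a in A) #|[set b in B | r a b]| = \sum_(b in B) #|[set a in A | r a b]|.
Proof.
have cardE (K : finType) (D : {set K}) (s : K -> bool) :
    #|[set d in D | s d]| = \sum_(d in D) s d.
  rewrite -sum1_card big_mkcond [RHS]big_mkcond; apply: eq_bigr => d _.
  by rewrite inE; case: (d \in D); case: (s d).
under eq_bigr do rewrite cardE.
by rewrite exchange_big; under [RHS]eq_bigr do rewrite cardE.
Qed.

Lemma pcore_setI_normal (gT : finGroupType) (p : nat) (G H K : {group gT}) :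
  K <| G -> K \subset H -> 'O_p(H) :&: K \subset 'O_p(G).
Proof.
move=> nKG sKH; apply: (@subset_trans _ _ 'O_p(K)); last first.
  by apply: pcore_max; [exact: pcore_pgroup|exact: char_normal_trans (pcore_char _ _) nKG].
apply: pcore_max; first by apply: pgroupS (subsetIl _ _) (pcore_pgroup _ _).
by rewrite /= setIC (normalGI sKH) ?pcore_normal.
Qed.

(** Double counting pairs (g, x) with x in B :&: S^g makes P = S :&: A commensurable with P^g for a
    dense set of g. That set generates [H1], to which [bergman_lenstra] applies. *)
Theorem Sylow_pcore_index (a m : nat) :
  exists f : nat, forall (gT : finGroupType) (p : nat) (H S A B : {group gT}),
    p.-Sylow(H) S -> A <| H -> B \subset S :&: A -> #|S :&: A : B| <= a ->
    (forall x, x \in B -> #|H : 'C[x]|`_p^' <= m)%N ->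
  #|S :&: A : 'O_p(H)| <= f.
Proof.
pose n0 := (a * (2 * m))%N; pose n := (n0 ^ (3 * (2 * m)).+1)%N.
have [K hK] := bergman_lenstra n.
exists (K * K ^ K * (2 * m) ^ (2 * m))%N => gT p H S A B sylS nAH sBP PB Bm.
set P := (S :&: A)%G; have sSH := pHall_sub sylS.
have sPS : P \subset S := subsetIl _ _.
have sPH : P \subset H := subset_trans sPS sSH.
have sBS : B \subset S := subset_trans sBP sPS.
pose X := [set g in H | #|P : P :^ g| <= n0].
have Xdense : #|H| <= 2 * m * #|X|.
  pose r (g x : gT) := x \in S :^ g.
  have : 2 * (#|H| * #|B|) <= 2 * m * \sum_(g in H) #|[set x in B | r g x]|.
    rewrite exchange_card -mulnA leq_mul2l /= big_distrr /= mulnC -sum_nat_const.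
    by apply: leq_sum => x Bx; apply: (conj_Sylow_density sylS); rewrite ?(subsetP sBS) ?Bm.
  move/(dense_fibers (cardG_gt0 B))/leq_trans; apply.
  rewrite leq_mul2l; apply/orP; right; apply: subset_leq_card.
  apply/subsetP=> g /setIdP[Hg Bg]; apply/setIdP; split=> //.
  apply: leq_trans (leq_index_trans _ B _) (leq_mul PB _).
  (* B lies in the normal subgroup A, so its elements in S^g are automatically in (S :&: A)^g. *)
  have BSE : [set x in B | r g x] = B :&: P :^ g.
    apply/setP=> x; rewrite inE in_setI; case Bx: (x \in B) => //=.
    rewrite /r conjIg in_setI; suff -> : x \in A :^ g by rewrite andbT.
    rewrite (normP (subsetP (normal_norm nAH) g Hg)).
    by have /setIP[] := subsetP sBP x Bx.
  have B0 : 0 < #|B :&: P :^ g| by exact: cardG_gt0.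
  by rewrite -(leq_pmul2l B0) (LagrangeI B (P :^ g)%G) mulnC -BSE.
have n0_gt0 : 0 < n0.
  rewrite !muln_gt0 /= (leq_trans (indexg_gt0 _ _) PB).
  by rewrite (leq_trans _ (Bm 1 (group1 _))) // part_gt0.
have X1 : 1 \in X by rewrite inE group1 conjsg1 indexgg.
have XV x : x \in X -> x^-1 \in X.
  suff iV : #|P : P :^ x^-1| = #|P : P :^ x| by rewrite !inE groupV iV.
  by rewrite -indexgJC -(indexJg _ _ x) -conjsgM mulVg conjsg1.
have sXH : X \subset H by apply/subsetP=> x /setIdP[].
have genX := gen_dense_set X1 XV sXH Xdense.
set H1 := <<X>>%G; have sH1H : H1 \subset H by rewrite gen_subG.
have iH1 : #|H : H1| <= 2 * m.
  rewrite -(leq_pmul2l (cardG_gt0 H1)) Lagrange //= mulnC.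
  by rewrite (leq_trans Xdense) // leq_mul2l subset_leq_card ?orbT ?subset_gen.
have sPH1 : P \subset H1.
  apply: subset_trans (subset_gen _); apply/subsetP=> g Pg.
  by rewrite inE (subsetP sPH) //= conjGid // indexgg.
have iPg g : g \in H1 -> #|P : P :^ g| <= n.
  rewrite /H1 /= genX /n; elim: (3 * _)%N.+1 g => [|j IH] g.
    by rewrite expg0 => /set1P ->; rewrite conjsg1 indexgg.
  rewrite expgSr => /mulsgP[y z /IH yj /setIdP[_ zn] ->].
  rewrite expnS conjsgM (leq_trans (leq_index_trans _ (P :^ z)%G _)) // leq_mul //.
  by rewrite indexJg.
have [L [N [nLH1 sNL sNP iPN iLN]]] := hK gT H1 P sPH1 iPg.
(* Only N is known to be a p-group; its core in L is a normal p-subgroup of L of bounded index. *)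
have sCO : gcore N L \subset 'O_p(H1).
  apply: subset_trans (_ : 'O_p(L) \subset _).
    apply: pcore_max; last exact: gcore_normal.
    by apply: pgroupS (gcore_sub _ _) (pgroupS (subset_trans sNP sPS) (pHall_pgroup sylS)).
  by apply: pcore_max; [exact: pcore_pgroup | exact: char_normal_trans (pcore_char _ _) nLH1].
have iPO : #|P : 'O_p(H1)| <= K * K ^ K.
  apply: leq_trans (leq_index_trans _ N _) (leq_mul iPN _).
  apply: (@leq_trans #|N : gcore N L|); first by rewrite dvdn_leq ?indexg_gt0 // indexgS.
  by apply: leq_trans (leq_index_subset _ sNL) (leq_index_gcore _).
(* Intersecting with the core of [H1] in H, which is normal in H, brings O_p(H1) down into
   O_p(H). *)
have nCH := gcore_normal sH1H; have sCH1 := gcore_sub H1 H.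
apply: (@leq_trans #|P : 'O_p(H1) :&: gcore H1 H|).
  by rewrite dvdn_leq ?indexg_gt0 // indexgS // pcore_setI_normal.
apply: leq_trans (leq_index_setI _ _ _) (leq_mul iPO _).
by apply: leq_trans (leq_index_subset _ sPH) (leq_index_gcore _).
Qed.

(** * Near commutation of Sylow subgroups, and exact centralisation at large primes *)

(** Directed: a large part of Q has large centralisers in P. In this form the condition passes
    easily to conjugates and quotients. *)
Definition nearly_commutes (gT : finGroupType) (c : nat) (P Q : {group gT}) : Prop :=
  exists Q0 : {group gT}, [/\ Q0 \subset Q, #|Q : Q0| <= c &
    forall x, x \in Q0 -> #|P : 'C[x]| <= c].

Definition nearly_commuting_Sylows (gT : finGroupType) (c : nat)
    (G T : {group gT}) : Prop :=
  forall p q : nat, p \in \pi(T) -> q \in \pi(G) -> p != q ->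
  exists P Q : {group gT}, [/\ p.-Sylow(T) P, q.-Sylow(G) Q,
    nearly_commutes c P Q & nearly_commutes c Q P].

Lemma nearly_commutesJ (gT : finGroupType) (c : nat) (P Q : {group gT}) (g : gT) :
  nearly_commutes c P Q -> nearly_commutes c (P :^ g) (Q :^ g).
Proof.
case=> Q0 [sQ0Q iQ0 Q0P]; exists (Q0 :^ g)%G; split; rewrite ?conjSg ?indexJg //.
move=> x; rewrite mem_conjg => /Q0P; congr (_ <= _); rewrite -(indexJg P _ g) /=.
by rewrite -!cent_set1 -centJ conjg_set1 conjgKV.
Qed.

Lemma nearly_commutes_quotient (gT : finGroupType) (c : nat) (P Q N : {group gT}) :
  P \subset 'N(N) -> Q \subset 'N(N) ->
  nearly_commutes c P Q -> nearly_commutes c (P / N) (Q / N).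
Proof.
move=> nNP nNQ [Q0 [sQ0Q iQ0 Q0P]]; exists (Q0 / N)%G.
have sI (A B : {group gT}) : A \subset 'N(N) -> A :&: B \subset 'N(N).
  exact: subset_trans (subsetIl _ _).
split; first exact: quotientS.
  by apply: leq_trans iQ0; apply: dvdn_leq => //; apply: index_quotient; exact: sI.
move=> _ /morphimP[x nNx Q0x ->] /=; apply: leq_trans (Q0P x Q0x).
apply: (@leq_trans #|P / N : 'C_P[x] / N|); last first.
  by rewrite -[leqRHS]indexgI; apply: dvdn_leq => //; apply: index_quotient; exact: sI.
rewrite dvdn_leq ?indexg_gt0 // indexgS //.
apply/subsetP=> _ /morphimP[y nNy /setIP[_ /cent1P cxy] ->].
by apply/cent1P; rewrite /commute -!morphM // cxy.
Qed.

Lemma pgroup_index_small (gT : finGroupType) (p : nat) (P H : {group gT}) :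
  prime p -> p.-group P -> #|P : H| < p -> P \subset H.
Proof.
move=> pp pP lt_p; rewrite -indexg_eq1; apply: contraTT lt_p => i1; rewrite -leqNgt.
have pi : p.-nat #|P : H| by apply: pnat_dvd (dvdn_indexg _ _) pP.
have [[|j] jE] := p_natP pi; first by rewrite jE in i1.
by rewrite jE -{1}[p]expn1 leq_pexp2l // prime_gt0.
Qed.

(** For p > c a centraliser of index at most c in the p-group P must be all of P. *)
Lemma nearly_commutes_cent (gT : finGroupType) (p c : nat) (P Q : {group gT}) :
  prime p -> p.-group P -> c < p -> nearly_commutes c P Q -> #|Q : 'C(P)| <= c.
Proof.
move=> pp pP ltcp [Q0 [sQ0Q iQ0 Q0P]].
apply: leq_trans iQ0; rewrite dvdn_leq ?indexg_gt0 // indexgS //.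
apply/subsetP=> x /Q0P iP; rewrite -sub_cent1.
by apply: (pgroup_index_small pp pP); exact: leq_ltn_trans iP ltcp.
Qed.

Section NilpotentQuotient.

Variables (gT : finGroupType) (c : nat) (G T : {group gT}).
Hypotheses (nTG : T <| G) (nilGT : nilpotent (G / T)).
Hypotheses (c_gt0 : 0 < c) (comT : nearly_commuting_Sylows c G T).

(** The hypothesis supplies some pair; conjugating in G, which normalises T, allows Q to be
    prescribed. *)
Lemma nearly_commuting_SylowP (p q : nat) (Q : {group gT}) :
  p \in \pi(T) -> q \in \pi(G) -> p != q -> q.-Sylow(G) Q ->
  exists P : {group gT},
    [/\ p.-Sylow(T) P, nearly_commutes c P Q & nearly_commutes c Q P].
Proof.
move=> pT qG pq sylQ; have [P [Q1 [sylP sylQ1 PQ QP]]] := comT pT qG pq.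
have [g Gg QE] := Sylow_trans sylQ1 sylQ.
have {sylQ}-> : Q = (Q1 :^ g)%G by exact/val_inj.
exists (P :^ g)%G; split; try exact: nearly_commutesJ.
by rewrite pHallJnorm // (subsetP (normal_norm nTG)).
Qed.

Lemma join_Sylow_normal (q : nat) (Q : {group gT}) :
  q.-Sylow(G) Q -> T <*> Q <| G.
Proof.
move=> sylQ; have nTQ : Q \subset 'N(T).
  exact: subset_trans (pHall_sub sylQ) (normal_norm nTG).
rewrite norm_joinEr // -quotientK // -[gval G](quotientGK nTG) cosetpre_normal.
by rewrite (nilpotent_Hall_pcore nilGT (quotient_pHall nTQ sylQ)) pcore_normal.
Qed.

(** As q > c, a subgroup of index at most c in a Sylow p-subgroup of T centralises Q, so |T :
    N_T(Q)| is at most c^c < q. Hence TQ has fewer than q Sylow q-subgroups, a number congruent to 1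
    modulo q, so just one. *)
Lemma large_Sylow_normal (q : nat) (Q : {group gT}) :
  q \in \pi(G) -> maxn c (c ^ c) < q -> q.-Sylow(G) Q -> Q <| G.
Proof.
rewrite gtn_max => qG /andP[ltcq ltBq] sylQ.
have [pq qQ] : prime q /\ q.-group Q.
  by split; [move: qG; rewrite mem_primes => /andP[] | exact: pHall_pgroup sylQ].
have nTQ : Q \subset 'N(T).
  exact: subset_trans (pHall_sub sylQ) (normal_norm nTG).
pose H := (T <*> Q)%G; have nHG : H <| G := join_Sylow_normal sylQ.
have HE : H = T * Q :> {set gT} by exact: norm_joinEr.
have sQH : Q \subset H by exact: joing_subr.
have sylHQ : q.-Sylow(H) Q := pHall_subl sQH (normal_sub nHG) sylQ.
have iTN : #|T : 'N(Q)| <= c ^ c.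
  apply: leq_exp_of_parts; first exact: indexg_gt0.
  move=> p pi; have pT : p \in \pi(T).
    by apply: pi_of_dvd pi; rewrite ?cardG_gt0 // dvdn_indexg.
  (* For p = q the Sylow subgroup T :&: Q of T lies in Q and normalises it. *)
  have [->|pq'] := eqVneq p q.
    apply: leq_trans (leq_index_part _ (Sylow_setI_normal nTG sylQ)) _.
    rewrite -indexgI (setIidPl _) ?indexgg //.
    exact: subset_trans (subsetIr _ _) (normG _).
  have [P [sylP _ QP]] := nearly_commuting_SylowP pT qG pq' sylQ.
  apply: leq_trans (leq_index_part _ sylP) (leq_trans _ (nearly_commutes_cent pq qQ ltcq QP)).
  by rewrite dvdn_leq ?indexg_gt0 // indexgS // cent_sub.
have iHN : #|H : 'N_H(Q)| <= c ^ c.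
  rewrite indexgI (leq_trans _ iTN) //.
  have NH0 : 0 < #|'N_H(Q)| by exact: cardG_gt0.
  have T0 : 0 < #|T :&: 'N(Q)| by exact: cardG_gt0.
  rewrite -(leq_pmul2l NH0) LagrangeI -(leq_pmul2l T0) mulnCA LagrangeI.
  rewrite [leqRHS]mulnC (mul_cardG T 'N_H(Q)%G) mulnC leq_mul //.
    rewrite subset_leq_card // {1}HE mulgS //.
    by rewrite subsetI sQH normG.
  by rewrite subset_leq_card // setIA (setIidPl (joing_subl _ _)).
have := card_Syl_mod H pq; rewrite (card_Syl sylHQ) modn_small ?(leq_ltn_trans iHN) // => /eqP.
rewrite indexg_eq1 subsetI => /andP[_ nQH].
have nQ : Q <| H by exact/andP.
by rewrite -(normal_Hall_pcore sylHQ nQ) (char_normal_trans (pcore_char _ _) nHG).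
Qed.

End NilpotentQuotient.

(** [Sylow_pcore_index] is applied to H = TQ and A = C :&: H. The subgroup C disposes of the primes
    above b; only the at most b+1 small ones cost a factor c in the index. *)
Theorem nearly_commuting_pcore_index (c : nat) :
  exists f : nat, forall (gT : finGroupType) (G T C Q : {group gT}) (q : nat),
    T <| G -> nilpotent (G / T) -> 0 < c -> nearly_commuting_Sylows c G T ->
    q \in \pi(G) -> q.-Sylow(G) Q -> C <| G ->
    (forall (p : nat) (P : {group gT}), p \in \pi(T) -> p != q ->
       maxn c (c ^ c) < p -> p.-Sylow(T) P -> Q :&: C \subset 'C(P)) ->
  #|Q :&: C : 'O_q(G)| <= f.
Proof.
set b := maxn c (c ^ c).
have [f hf] := Sylow_pcore_index (c ^ b.+1) (c ^ c).
exists f => gT G T C Q q nTG nilGT c0 comT qG sylQ nCG CP.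
pose H := (T <*> Q)%G; have nHG : H <| G := join_Sylow_normal nTG nilGT sylQ.
have nTQ : Q \subset 'N(T).
  exact: subset_trans (pHall_sub sylQ) (normal_norm nTG).
have HE : H = T * Q :> {set gT} by exact: norm_joinEr.
have sQH : Q \subset H by exact: joing_subr.
have sTH : T \subset H by exact: joing_subl.
have sylHQ : q.-Sylow(H) Q := pHall_subl sQH (normal_sub nHG) sylQ.
have qHT : q.-nat #|H : T|.
  rewrite -card_quotient; last by rewrite join_subG normG.
  by rewrite HE quotientMidl; apply: quotient_pgroup (pHall_pgroup sylQ).
have sylH p (P : {group gT}) : p != q -> p.-Sylow(T) P -> p.-Sylow(H) P.
  move=> pq sylP; rewrite pHallE (subset_trans (pHall_sub sylP) sTH) /=.
  rewrite (card_Hall sylP) -(Lagrange sTH) partnM ?cardG_gt0 ?indexg_gt0 //.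
  rewrite (@part_p'nat p #|H : T|) ?muln1 //.
  by apply: pi_pnat qHT _; rewrite !inE eq_sym.
(* [F p] is the part of Q with large centralisers in a Sylow p-subgroup of T; the trivial group is a
   dummy value at irrelevant p. *)
have /choice[F hF] (p : nat) : exists D : {group gT},
  p \in \pi(T) -> p != q -> exists2 P : {group gT}, p.-Sylow(T) P &
    [/\ D \subset Q, #|Q : D| <= c & forall x, x \in D -> #|P : 'C[x]| <= c].
  have [pT|] := boolP (p \in \pi(T)); last by exists 1%G.
  have [->|pq] := eqVneq p q; first by exists 1%G.
  have [P [sylP [D hD] _]] := nearly_commuting_SylowP nTG comT pT qG pq sylQ.
  by exists D => _ _; exists P.
pose D := (Q :&: C :&:
  \bigcap_(p < b.+1 | ((p : nat) \in \pi(T)) && (p != q :> nat)) F p)%G.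
have QCE : Q :&: (C :&: H) = Q :&: C by rewrite setIA setIAC (setIidPl sQH).
have sOG : 'O_q(H) \subset 'O_q(G).
  by apply: pcore_max; [exact: pcore_pgroup | exact: char_normal_trans (pcore_char _ _) nHG].
apply: (@leq_trans #|Q :&: C : 'O_q(H)|).
  by rewrite dvdn_leq ?indexg_gt0 // indexgS.
have := hf gT q H Q (C :&: H)%G D sylHQ; rewrite /= QCE; apply.
- by rewrite /normal subsetIr normsI ?normG // (subset_trans (normal_sub nHG) (normal_norm nCG)).
- exact: subsetIl.
- rewrite indexgI; apply: leq_trans (leq_index_subset _ (subsetIl Q C)) _.
  apply: leq_index_bigcap => //; first by rewrite (leq_trans (max_card _)) // card_ord.
  by move=> p /andP[pT pq]; have [P _ []] := hF p pT pq.
move=> x /setIP[QCx /bigcapP Fx]; apply: leq_exp_of_parts; first exact: part_gt0.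
move=> p; set n := #|H : _| => pn.
have [pq pH] : p != q /\ p \in \pi(n).
  move: pn; rewrite !mem_primes => /and3P[pp _ pd]; split.
    have : p \in q^' by apply: (pnatP _ (part_gt0 _ _) (part_pnat _ n)) pd.
    by rewrite !inE.
  by rewrite pp indexg_gt0 (dvdn_trans pd) // dvdn_part.
rewrite partn_part; last by move=> r /eqP ->; rewrite !inE.
have pT : p \in \pi(T).
  have : p \in \pi(H) by apply: pi_of_dvd pH; rewrite ?cardG_gt0 // dvdn_indexg.
  rewrite !mem_primes !cardG_gt0 /= -(Lagrange sTH) => /andP[pp].
  rewrite pp Euclid_dvdM //= => /orP[//|pd].
  by have := pnatP _ (indexg_gt0 _ _) qHT p pp pd; rewrite !inE (negPf pq).
(* A small p is controlled by x in [F p]; for a large p, x centralises the whole Sylow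
   p-subgroup. *)
have [lepb|ltbp] := leqP p b.
  have [P sylP [_ _ Pc]] := hF p pT pq.
  apply: leq_trans (leq_index_part _ (sylH p P pq sylP)) (Pc x _).
  by apply: (Fx (Ordinal (lepb : p < b.+1))); rewrite /= pT.
have [P sylP] := Sylow_exists p T.
apply: leq_trans (leq_index_part _ (sylH p P pq sylP)) _.
rewrite -indexgI (setIidPl _) ?indexgg //.
by rewrite sub_cent1 (subsetP (CP p P pT pq ltbp sylP)).
Qed.

(** * The nilpotent residual, and the passage from probabilities to near commutation *)

(** The series is decreasing, so a term of least order equals all later ones. *)
Lemma gamma_infty_lcn (gT : finGroupType) (G : {group gT}) :
  exists n, gamma_infty G = 'L_n(G).
Proof.
have ex_card : exists i, `[< exists n, #|'L_n(G)| = i >].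
  by exists #|'L_0(G)|; apply/asboolP; exists 0.
case: (ex_minnP ex_card) => _ /asboolP[n <-] min_n; exists n.
apply/setP=> x; rewrite inE; apply/asboolP/idP => [//|Lx m].
have [lemn|/ltnW lenm] := leqP m n; first exact: subsetP (lcn_sub_leq G lemn) x Lx.
suff -> : 'L_m(G) = 'L_n(G) by [].
apply/eqP; rewrite eqEcard lcn_sub_leq // min_n //.
by apply/asboolP; exists m.
Qed.

Lemma nilpotent_quotient_lcn (gT : finGroupType) (G : {group gT}) (n : nat) :
  nilpotent (G / 'L_n(G)).
Proof.
apply/lcnP; exists n; apply/trivgP; apply: subset_trans (lcn_subS _ _) _.
have <- := morphim_lcn (coset 'L_n(G)) n (normal_norm (lcn_normal n G)).
by rewrite -[_ @* _]/('L_n(G) / 'L_n(G)) trivg_quotient.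
Qed.

(** In the abelian group <x> the index of <x> :&: H is at most c, so it divides c!, an exponent
    independent of x and H. *)
Lemma expg_fact_index (gT : finGroupType) (G H : {group gT}) (c : nat) (x : gT) :
  #|G : H| <= c -> x \in G -> x ^+ c`! \in H.
Proof.
move=> GHc Gx; set X := <[x]>%G; set D := (X :&: H)%G.
have XDc : #|X : D| <= c.
  by rewrite indexgI (leq_trans (leq_index_subset _ _) GHc) ?cycle_subG.
have nDX : X \subset 'N(D) by apply: sub_abelian_norm (cycle_abelian x) (subsetIl _ _).
have Xx : x \in X by exact: cycle_id.
have : coset D (x ^+ c`!) = 1.
  have/dvdnP[j ->] : #|X : D| %| c`! by rewrite dvdn_fact ?indexg_gt0.
  rewrite mulnC morphX ?(subsetP nDX) // expgM -card_quotient //.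
  by rewrite expg_cardG ?expg1n // mem_quotient.
by move/coset_idr => /(_ (subsetP nDX _ (groupX _ Xx)))/setIP[].
Qed.

Lemma nearly_commuting_Sylows_quotient (gT : finGroupType) (c : nat)
    (G T N : {group gT}) :
  T \subset G -> N <| G -> nearly_commuting_Sylows c G T ->
  nearly_commuting_Sylows c (G / N) (T / N).
Proof.
move=> sTG nNG comT p q pT qG pq.
have nN (A : {group gT}) : A \subset G -> A \subset 'N(N).
  by move=> sAG; exact: subset_trans sAG (normal_norm nNG).
have piq (A : {group gT}) (r : nat) : r \in \pi(A / N) -> r \in \pi(A).
  by apply: pi_of_dvd; rewrite ?cardG_gt0 // dvdn_quotient.
have [P [Q [sylP sylQ PQ QP]]] := comT p q (piq T p pT) (piq G q qG) pq.
have nP : P \subset 'N(N) by exact: nN (subset_trans (pHall_sub sylP) sTG).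
have nQ : Q \subset 'N(N) by exact: nN (pHall_sub sylQ).
exists (P / N)%G, (Q / N)%G.
by split; rewrite ?quotient_pHall //; exact: nearly_commutes_quotient.
Qed.

Lemma comm_pr_nearly_commutes (R : realType) (gT : finGroupType) (eps : R)
    (k : nat) (P Q : {group gT}) :
  (0 < eps)%R -> (2%:R / eps < k%:R)%R -> (eps <= comm_pr R P Q)%R ->
  nearly_commutes (k ^ (3 * k).+1) P Q /\ nearly_commutes (k ^ (3 * k).+1) Q P.
Proof.
move=> eps0 ltk; rewrite /comm_pr ler_pdivlMr; last first.
  by rewrite mulr_gt0 // ltr0n cardG_gt0.
move=> le_eps.
(* The bound k > 2/eps provides the factor 2 that the averaging in [dense_fibers] consumes. *)
have dense : 2 * (#|P| * #|Q|) <= k * #|comm_pairs P Q|.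
  rewrite -(ler_nat R) !natrM -(ler_pM2l eps0).
  apply: (@le_trans _ _ (2%:R * #|comm_pairs P Q|%:R)%R).
    by rewrite mulrCA ler_pM2l ?ltr0n.
  by rewrite mulrA ler_wpM2r ?ler0n // -ler_pdivrMl // mulrC ltW.
have k0 : 0 < k.
  by rewrite -(ltr_nat R) (le_lt_trans _ ltk) // divr_ge0 ?ler0n // ltW.
have le_k : k <= k ^ (3 * k).+1 by rewrite -{1}[k]expn1 leq_pexp2l.
split.
  have [|Q0 [sQ0 iQ0] Q0P] := @comm_dense_subgroup _ P Q k.
    by rewrite card_comm_pairsC [(#|Q| * _)%N]mulnC.
  by exists Q0; split=> //; exact: leq_trans iQ0 le_k.
have [P0 [sP0 iP0] P0Q] := comm_dense_subgroup dense.
by exists P0; split=> //; exact: leq_trans iP0 le_k.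
Qed.

Lemma prstar_nearly_commuting (R : realType) (eps : R) :
  (0 < eps)%R ->
  exists2 c : nat, 0 < c & forall (gT : finGroupType) (G T : {group gT}),
    prstar_ge T G eps -> nearly_commuting_Sylows c G T.
Proof.
move=> eps0; have e0 : (0 <= 2%:R / eps)%R by rewrite divr_ge0 ?ler0n // ltW.
have := archi_boundP e0; set k := Num.bound _ => ltk.
exists (k ^ (3 * k).+1)%N.
  by rewrite expn_gt0 -(ltr_nat R) (le_lt_trans e0 ltk).
move=> gT G T prTG p q pT qG pq; have [P [Q [PT QG le_eps]]] := prTG p q pT qG pq.
have [PQ QP] := comm_pr_nearly_commutes eps0 ltk le_eps.
by move: PT QG; rewrite !inE => PT QG; exists P, Q; split.
Qed.

Lemma pcore_sub_Fitting (gT : finGroupType) (p : nat) (G : {group gT}) :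
  'O_p(G) \subset 'F(G).
Proof. exact: Fitting_max (pcore_normal _ _) (pgroup_nil (pcore_pgroup _ _)). Qed.

(** * The two bounds *)

Lemma Fitting2_index_bound (c : nat) :
  0 < c -> exists N : nat, forall (gT : finGroupType) (G T : {group gT}) (n : nat),
    T = 'L_n(G) :> {set gT} -> nearly_commuting_Sylows c G T ->
  #|G : Fitting2 G| <= N.
Proof.
move=> c0; have [f hf] := nearly_commuting_pcore_index c.
exists (f ^ f)%N => gT G T n TE comT.
have nTG : T <| G by rewrite TE lcn_normal.
have nilGT : nilpotent (G / T) by rewrite TE nilpotent_quotient_lcn.
have nFG : 'F(G) <| G := Fitting_normal G.
set Gb := (G / 'F(G))%G.
have -> : #|G : Fitting2 G| = #|Gb : 'F(Gb)|.
  by rewrite /Fitting2 -{1}[gval G](quotientGK nFG) index_cosetpre.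
apply: leq_exp_of_parts => // q qi.
have qGb : q \in \pi(Gb) by apply: pi_of_dvd qi; rewrite ?cardG_gt0 ?dvdn_indexg.
have [Q sylQ] := Sylow_exists q Gb.
apply: leq_trans (leq_index_part _ sylQ) _.
apply: (@leq_trans #|Q : 'O_q(Gb)|).
  by rewrite dvdn_leq ?indexg_gt0 // indexgS // pcore_sub_Fitting.
have TbE : T / 'F(G) = 'L_n(Gb).
  by rewrite TE -[_ / _]/(_ @* _) morphim_lcn // normal_norm.
(* With C the whole group G/F(G), the condition on large primes holds vacuously: the large Sylow
   subgroups of G are normal, hence inside F(G), and their primes do not divide |G/F(G)|. *)
have := hf _ Gb (T / 'F(G))%G Gb Q q; rewrite (setIidPl (pHall_sub sylQ)); apply=> //.
- exact: quotient_normal.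
- by rewrite /= TbE nilpotent_quotient_lcn.
- exact: nearly_commuting_Sylows_quotient (normal_sub nTG) nFG comT.
move=> p P pTb _ ltp _; have [S sylS] := Sylow_exists p G.
have pGb : p \in \pi(Gb).
  by apply: pi_of_dvd pTb; rewrite ?cardG_gt0 // cardSg // quotientS // normal_sub.
have pG : p \in \pi(G) by apply: pi_of_dvd pGb; rewrite ?cardG_gt0 // dvdn_quotient.
have nSG := large_Sylow_normal nTG nilGT c0 comT pG ltp sylS.
have sSF : S \subset 'F(G) := Fitting_max nSG (pgroup_nil (pHall_pgroup sylS)).
have := card_Hall (quotient_pHall (subset_trans (pHall_sub sylS) (normal_norm nFG)) sylS).
rewrite /= quotientS1 // cards1 => p1.
by move: pGb; rewrite -p_part_gt1 -p1.
Qed.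

Lemma exponent_Fitting_bound (c : nat) :
  0 < c -> exists N : nat, forall (gT : finGroupType) (G T : {group gT}),
    T <| G -> nilpotent (G / T) -> nearly_commuting_Sylows c G T ->
  exponent (G / 'F(G)) <= N.
Proof.
move=> c0; have [f hf] := nearly_commuting_pcore_index c.
(* The power c! moves a q-element of G into C, and then f! moves it into O_q(G). *)
exists (c`! * f`!)%N => gT G T nTG nilGT comT.
have nFG : 'F(G) <| G := Fitting_normal G.
apply: dvdn_leq; first by rewrite muln_gt0 !fact_gt0.
apply/dvdn_partP => [|q]; first exact: exponent_gt0.
have [Q sylQ] := Sylow_exists q G; have sQG := pHall_sub sylQ.
have nFQ := subset_trans sQG (normal_norm nFG).
rewrite -(exponent_Hall (quotient_pHall nFQ sylQ)) pi_of_exponent => qGb.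
have qG : q \in \pi(G) by apply: pi_of_dvd qGb; rewrite ?cardG_gt0 // dvdn_quotient.
pose big p := [&& p \in \pi(T), maxn c (c ^ c) < p & p != q].
(* Using O_p(T), characteristic in T, makes C normal in G; for these p it is the Sylow p-subgroup of
   T. Primes dividing |T| are at most |T|, so the finite range misses none. *)
pose C := (G :&: \bigcap_(p < #|T|.+1 | big p) 'C('O_p(T)))%G.
have nCG : C <| G.
  rewrite /normal subsetIl normsI ?normG // norms_bigcap //.
  apply/bigcapsP=> p _; apply: norms_cent.
  exact: normal_norm (char_normal_trans (pcore_char _ _) nTG).
have CP (p : nat) (P : {group gT}) : p \in \pi(T) -> p != q ->
    maxn c (c ^ c) < p -> p.-Sylow(T) P -> Q :&: C \subset 'C(P).
  move=> pT pq ltp sylP.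
  have pG : p \in \pi(G) by apply: pi_of_dvd pT; rewrite ?cardG_gt0 // cardSg // normal_sub.
  have [S sylS] := Sylow_exists p G.
  have nSG := large_Sylow_normal nTG nilGT c0 comT pG ltp sylS.
  have sylTS := Sylow_setI_normal nTG sylS.
  have nTS : T :&: S <| T := normalGI (normal_sub nTG) nSG.
  have sPO : P \subset 'O_p(T).
    rewrite (normal_Hall_pcore sylTS nTS) (sub_normal_Hall sylTS nTS) ?(pHall_sub sylP) //.
    exact: pHall_pgroup sylP.
  have lep : p < #|T|.+1.
    by move: pT; rewrite mem_primes => /and3P[_ T0 pdT]; rewrite ltnS dvdn_leq.
  apply: subset_trans (centS sPO); apply: subset_trans (subsetIr _ _) _.
  apply: subset_trans (subsetIr _ _) (bigcap_inf (Ordinal lep) _).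
  by rewrite /big /= pT ltp pq.
apply/exponentP=> _ /morphimP[y nFy Qy ->].
rewrite -morphX //; apply: coset_id; apply: (subsetP (pcore_sub_Fitting q G)).
rewrite expgM; apply: (expg_fact_index (hf gT G T C Q q nTG nilGT c0 comT qG sylQ nCG CP)).
rewrite inE groupX //= inE groupX ?(subsetP sQG) //=.
apply/bigcapP=> p /and3P[pT ltp pq].
have [P [sylP PQ _]] := nearly_commuting_SylowP nTG comT pT qG pq sylQ.
have pp : prime p by move: pT; rewrite mem_primes => /andP[].
have ltcp : c < p by apply: leq_ltn_trans ltp; exact: leq_maxl.
(* O_p(T) lies in P, so it suffices to centralise P, and [nearly_commutes_cent] bounds |Q : C(P)| by
   c. *)
apply: (subsetP (centS (pcore_sub_Hall sylP))).
exact: expg_fact_index (nearly_commutes_cent pp (pHall_pgroup sylP) ltcp PQ) Qy.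
Qed.

Theorem theorem1p1 (R : realType) (eps : R) (eps_gt0 : (0 < eps)%R) :
  (exists N1 : nat, forall (gT : finGroupType) (G T : {group gT}),
     T = gamma_infty_group G -> prstar_ge T G eps ->
     #|G : Fitting2 G| <= N1)
  /\
  (exists N2 : nat, forall (gT : finGroupType) (G T : {group gT}),
     T = gamma_infty_group G -> prstar_ge T G eps ->
     exponent (G / 'F(G)) <= N2).
Proof.
have [c c0 hc] := prstar_nearly_commuting eps_gt0.
have [N1 hN1] := Fitting2_index_bound c0.
have [N2 hN2] := exponent_Fitting_bound c0.
split; [exists N1 | exists N2] => gT G T TE /hc comT.
  by have [n GE] := gamma_infty_lcn G; apply: (hN1 gT G T n _ comT); rewrite TE.
have [n GE] := gamma_infty_lcn G.
by apply: (hN2 gT G T _ _ comT); rewrite TE /= GE ?lcn_normal ?nilpotent_quotient_lcn.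
Qed.
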